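(* Let $X_1, \ldots, X_n$ be probability spaces, let $X = X_1 \times \cdots \times X_n$ be the product probability space, and let $\phi_1, \ldots, \phi_m : X \to \mathbb{C}$ be measurable functions. Let $r \geq 2$ and $c \geq 1$ be integers. Assume that: (1) each $\phi_i$ is 1-Lipschitz in the Hamming metric, that is, $|\phi_i(x) - \phi_i(y)| \leq 1$ whenever $x = (x_1, \ldots, x_n)$ and $y = (y_1, \ldots, y_n)$ in $X$ differ in one coordinate; (2) each $\phi_i$ depends on at most $r$ coordinates, that is, for each $i = 1, \ldots, m$ there is a subset $J_i \subset \{1, \ldots, n\}$ with $|J_i| \leq r$ such that $\phi_i(x_1, \ldots, x_n) = \phi_i(y_1, \ldots, y_n)$ whenever $x_j = y_j$ for all $j \in J_i$; (3) for every $j = 1, \ldots, n$ there are at most $c$ functions $\phi_i$ that depend on the coordinate $x_j$, that is, $|\{i : j \in J_i\}| \leq c$ for all $j$. Let $f = \sum_{i=1}^m \phi_i$ and let $\lambda \in \mathbb{C}$ satisfy $$|\lambda| \leq \frac{1}{3c\sqrt{r-1}}.$$ Then $$\mathbf{E}\, e^{\lambda f} \neq 0.$$ Moreover, if, additionally, for some $L > 0$ we have $|\phi_i(x)| \leq L$ for all $x \in X$ and all $i = 1, \ldots, m$, then $$e^{|\lambda| m L} \geq \left|\mathbf{E}\, e^{\lambda f}\right| \geq e^{-|\lambda| m L}\left(\cos \frac{\pi}{4\sqrt{r-1}}\right)^n.$$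
   Context: $\mathbf{E}$ denotes expectation with respect to the product probability measure on $X$. For a point $x = (x_1, \ldots, x_n) \in X$, $x_j \in X_j$ is called the $j$-th coordinate of $x$. The Hamming distance between $x, y \in X$ is the number of indices $j$ with $x_j \neq y_j$. *)

(* Defs.v *)
From HB Require Import structures.
From mathcomp Require Import all_boot all_order all_algebra.
From mathcomp Require Import all_classical all_reals all_analysis.
From mathcomp Require Import complex.

Set Implicit Arguments.
Unset Strict Implicit.
Unset Printing Implicit Defensive.

Import Order.TTheory GRing.Theory Num.Theory.
Import numFieldNormedType.Exports.
Import ComplexField.Normc.

Local Open Scope classical_set_scope.
Local Open Scope ring_scope.
Local Open Scope complex_scope.

Section prod_space.
Context n (d : 'I_n -> measure_display) (T : forall i, measurableType (d i)).

Definition cylinders : set (set (forall i, T i)) :=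
  [set C | exists (i : 'I_n) (B : set (T i)),
             measurable B /\ C = [set x | B (x i)]].

Definition prod_space : measurableType cylinders.-sigma :=
  g_sigma_algebraType cylinders.

Lemma measurable_coord (i : 'I_n) :
  measurable_fun [set: prod_space] (fun x : prod_space => x i).
Proof.
move=> _ B mB; rewrite setTI.
by apply: sub_sigma_algebra; exists i, B.
Qed.

Lemma measurable_to_prod_space d' (S : measurableType d') (f : S -> prod_space) :
  (forall i, measurable_fun [set: S] (fun s => f s i)) ->
  measurable_fun [set: S] f.
Proof.
move=> mf; apply: (@measurability _ _ _ prod_space _ _ cylinders) => //.
move=> _ [_ [i [B [mB ->]]] <-].
exact: mf.
Qed.

Lemma measurable_box (A : forall i, set (T i)) :
  (forall i, measurable (A i)) ->
  measurable ([set x | forall i, A i (x i)] : set prod_space).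
Proof.
move=> mA.
have -> : [set x : prod_space | forall i, A i (x i)] =
          \bigcap_(i in [set: 'I_n]) [set x : prod_space | A i (x i)].
  by apply/seteqP; split=> x /= H; [move=> i _; exact: H|move=> i; exact: H].
apply: fin_bigcap_measurable => // i _.
by rewrite -[X in measurable X]setTI; exact: measurable_coord.
Qed.

End prod_space.
Arguments cylinders {n d} T.
Arguments prod_space {n d} T.

Section cons_point.
Context n (d : 'I_n.+1 -> measure_display)
  (T : forall i, measurableType (d i)).

Let tail_space := prod_space (fun i : 'I_n => T (lift ord0 i)).

Definition cons_point (u : T ord0 * tail_space) : prod_space T := fun i =>
  match unliftP ord0 i with
  | UnliftSome j ij => ecast k (T k) (esym ij) (u.2 j)
  | UnliftNone i0 => ecast k (T k) (esym i0) u.1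
  end.

Lemma cons_point0 u : cons_point u ord0 = u.1.
Proof.
rewrite /cons_point; case: unliftP => [j e|e]; first by have := congr1 val e.
by rewrite (eq_axiomK e).
Qed.

Lemma cons_pointS u j : cons_point u (lift ord0 j) = u.2 j.
Proof.
rewrite /cons_point; case: unliftP => [k e|e]; last by have := congr1 val e.
have jk : j = k by exact: (@lift_inj _ ord0).
by case: _ / jk in e *; rewrite (eq_axiomK e).
Qed.

Lemma measurable_cons_point : measurable_fun [set: T ord0 * tail_space] cons_point.
Proof.
apply: measurable_to_prod_space => i.
case: (unliftP ord0 i) => [j ->|->].
  have -> : cons_point^~ (lift ord0 j) = (fun u => u.2 j).
    by apply/funext => u; exact: cons_pointS.
  apply: (measurableT_comp (f := fun x : tail_space => x j)) => //.
  exact: measurable_coord.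
have -> : cons_point^~ ord0 = fst by apply/funext => u; exact: cons_point0.
exact: measurable_fst.
Qed.

HB.instance Definition _ :=
  isMeasurableFun.Build _ _ _ _ cons_point measurable_cons_point.

End cons_point.

Section prod_probability.
Context (R : realType).

Fixpoint prod_probability n : forall (d : 'I_n -> measure_display)
    (T : forall i, measurableType (d i)) (P : forall i, probability (T i) R),
    probability (prod_space T) R :=
  match n with
  | 0 => fun d T P =>
      (\d_(point : prod_space T) : probability (prod_space T) R)
  | n'.+1 => fun d T P =>
      (distribution (P ord0 \x prod_probability (fun i => P (lift ord0 i)))%E
         (@cons_point n' d T : {mfun _ >-> prod_space T}))
  end.

Lemma prod_probability_box n (d : 'I_n -> measure_display)
    (T : forall i, measurableType (d i)) (P : forall i, probability (T i) R)
    (A : forall i, set (T i)) :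
  (forall i, measurable (A i)) ->
  prod_probability P [set x | forall i, A i (x i)] = (\prod_(i < n) P i (A i))%E.
Proof.
elim: n d T P A => [|n IH] d T P A mA.
  rewrite big_ord0 /= diracE mem_set//.
  by case.
rewrite big_ord_recl /= /distribution /pushforward.
have -> : @cons_point n d T @^-1` [set x | forall i, A i (x i)] =
    A ord0 `*` [set y : prod_space (fun i => T (lift ord0 i)) |
                 forall i, A (lift ord0 i) (y i)].
  apply/seteqP; split=> [[u v] /= H|[u v] /= [H0 HS] i].
    split; first by have := H ord0; rewrite cons_point0.
    by move=> i; have := H (lift ord0 i); rewrite cons_pointS.
  case: (unliftP ord0 i) => [j ->|->].
    by rewrite cons_pointS; exact: HS.
  by rewrite cons_point0.
rewrite product_measure1E//.
  congr (_ * _)%E.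
  exact: (IH _ _ (fun i => P (lift ord0 i)) (fun i => A (lift ord0 i))).
exact: (@measurable_box n _ (fun i => T (lift ord0 i))
          (fun i => A (lift ord0 i))).
Qed.

End prod_probability.

Section complex_random_variables.
Context (R : realType).

Definition cexp (z : R[i]) : R[i] :=
  (expR (complex.Re z) * cos (complex.Im z)) +i*
  (expR (complex.Re z) * sin (complex.Im z)).

(* [R[i]^o] is [R[i]] with the topology of its modulus. *)
Definition borelC : measurableType (@open R[i]^o).-sigma :=
  g_sigma_algebraType (@open R[i]^o).

Definition cexpectation d (S : measurableType d) (P : probability S R)
    (Z : S -> R[i]) : R[i] :=
  fine ('E_P[fun x => complex.Re (Z x)])%E +i*
  fine ('E_P[fun x => complex.Im (Z x)])%E.

End complex_random_variables.
Arguments borelC R : clear implicits.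

Definition hamming n (d : 'I_n -> measure_display)
    (T : forall i, measurableType (d i)) (x y : prod_space T) : nat :=
  #|[set j : 'I_n | x j != y j]%SET|.

(* Main.v *)
(* Integrate the coordinates one at a time and control, for every set [s] of
   already integrated coordinates, the angle by which the partial expectation
   of exp(lambda f) turns when one further coordinate is changed: by induction
   on the size of [s] it is at most (2/3)/sqrt(r-1). Changing coordinate [j]
   amounts to changing the at most [c] functions phi_i with [j] in [J_i] one
   after the other. Each such change multiplies the integrand by a factor within
   9/7 |lambda| of 1 that depends on at most r-1 coordinates of [s]. Integrating
   the other coordinates of [s] first costs nothing, and by induction each of
   these r-1 integrations loses at most cos((2/3)/sqrt(r-1)) against the
   integral of the modulus, hence at most the constant 7/9 altogether. So each
   change turns the partial expectation by at most 2|lambda|, and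
   2 c |lambda| <= (2/3)/sqrt(r-1). Since (2/3)/sqrt(r-1) <= pi/(4 sqrt(r-1)),
   integrating all [n] coordinates loses at most the n-th power of
   cos(pi/(4 sqrt(r-1))). *)

Require Import Defs.
From mathcomp Require Import all_boot all_order all_algebra.
From mathcomp Require Import all_classical all_reals all_analysis.
From mathcomp Require Import measurable_realfun.
From mathcomp Require Import complex.
From mathcomp Require Import ring lra.

Import Order.TTheory GRing.Theory Num.Theory.
Import numFieldNormedType.Exports.
Import ComplexField.Normc.

Set Implicit Arguments.
Unset Strict Implicit.
Unset Printing Implicit Defensive.

Local Open Scope classical_set_scope.
Local Open Scope ring_scope.
Local Open Scope complex_scope.

(** * Elementary bounds for sine, cosine, exponential and arctangent *)

Section real_estimates.
Context {R : realType}.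
Implicit Types x y t : R.

Lemma sqr_sin_le x : sin x ^+ 2 <= x ^+ 2.
Proof.
suff H : forall y, 0 <= y -> sin y ^+ 2 <= y ^+ 2.
  by have [|] := leP 0 x => x0; [exact: H|rewrite -sqrrN -sinN -[leRHS]sqrrN H//; lra].
move=> y y0.
have [z _] := MVT_segment y0 (fun z _ => is_derive_sin z)
  (continuous_subspaceT (@continuous_sin R)).
rewrite sin0 !subr0 => ->.
rewrite exprMn ler_piMl ?sqr_ge0//.
Qed.

(** By the double angle formula, [cos x] is 1 minus twice the square of [sin (x / 2)]. *)
Lemma cos_ge_quadratic x : 1 - x ^+ 2 / 2 <= cos x.
Proof.
have xE : x = (x / 2) *+ 2 by rewrite mulr2n; lra.
rewrite [in leRHS]xE cos_mulr2n; have := sqr_sin_le (x / 2); rewrite sin2cos2.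
by rewrite [_ ^+ 2 *+ 2]mulr2n; lra.
Qed.

(** The quadratic bound at [pi / 2], where the cosine vanishes, gives pi^2 >= 8 > (8/3)^2. This is
    what makes 2/3 at most pi/4. *)
Lemma pi_ge8_3 : 8 / 3 <= pi :> R.
Proof.
have := cos_ge_quadratic (pi / 2); rewrite cos_pihalf.
have := @pi_ge2 R; nra.
Qed.

Lemma expR_sub1_le x : 0 <= x <= 1 / 3 -> expR x - 1 <= 9 / 7 * x.
Proof.
move=> /andP[x0 x1].
(* This is the cube of 1 - x/3 <= exp(-x/3); the bound on [expR x] then reduces to a polynomial
   inequality on [0, 1/3]. *)
have h : (1 - x / 3) ^+ 3 * expR x <= 1.
  have -> : expR x = expR (x / 3) ^+ 3.
    by rewrite -expRM_natl mulrC divfK.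
  rewrite -exprMn exprn_ile1//.
    by rewrite mulr_ge0 ?expR_ge0//; lra.
  rewrite -[leRHS](expR0 R) -(subrr (x / 3)) expRB.
  by rewrite mulrC ler_wpM2l ?expR_ge0// -expRN; have := expR_ge1Dx (- (x / 3)); lra.
suff : 1 <= (1 - x / 3) ^+ 3 * (1 + 9 / 7 * x).
  move=> h'; have := le_trans h h'; rewrite ler_pM2l ?exprn_gt0; lra.
nra.
Qed.

Lemma expR_sub1_sqr_le x : `|x| <= 1 / 3 -> (expR x - 1) ^+ 2 <= (9 / 7) ^+ 2 * x ^+ 2.
Proof.
move=> hx; rewrite -exprMn; case: (leP 0 x) => x0.
  have := expR_ge1Dx x; have := @expR_sub1_le x; rewrite -(ger0_norm x0) hx normr_ge0/=.
  by move=> /(_ isT); rewrite ger0_norm//; nra.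
have : expR x <= 1 by rewrite expR_le1; lra.
have := expR_ge1Dx x; nra.
Qed.

Lemma bernoulli_le x k : 0 <= x <= 1 -> 1 - k%:R * x <= (1 - x) ^+ k.
Proof.
move=> /andP[x0 x1]; elim: k => [|k IH]; first by rewrite expr0; lra.
rewrite exprS; apply: le_trans (ler_wpM2l _ IH); last lra.
by rewrite -natr1; have := ler0n R k; nra.
Qed.

(** The quadratic bound and Bernoulli's inequality give at least 1 - k g^2 / 2, and 7/9 = 1 -
    (2/3)^2 / 2. *)
Lemma cos_exp_ge (g : R) k : 0 <= g -> k%:R * g ^+ 2 <= (2 / 3) ^+ 2 -> g <= 2 / 3 ->
  7 / 9 <= cos g ^+ k.
Proof.
move=> g0 hk g1.
have hb := @bernoulli_le (g ^+ 2 / 2) k; have hc := cos_ge_quadratic g.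
apply: (@le_trans _ _ ((1 - g ^+ 2 / 2) ^+ k)).
  by apply: le_trans (hb _); nra.
by apply: lerXn2r => //; rewrite nnegrE; nra.
Qed.

Lemma atan_sqr_le t : atan t ^+ 2 <= t ^+ 2.
Proof.
suff H : forall y, 0 <= y -> atan y ^+ 2 <= y ^+ 2.
  by have [|] := leP 0 t => t0; [exact: H|rewrite -sqrrN -atanN -[leRHS]sqrrN H//; lra].
move=> y y0.
have [z _] := MVT_segment y0 (fun z _ => is_derive1_atan z)
  (continuous_subspaceT (@continuous_atan R)).
rewrite atan0 !subr0 => ->.
rewrite exprMn ler_piMl ?sqr_ge0//.
by rewrite exprn_ile1// ?invr_ge0 ?invf_le1; have := sqr_ge0 z; lra.
Qed.
End real_estimates.

(** * Modulus, exponential and angles of complex numbers *)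

Section complex_estimates.
Context {R : realType}.
Implicit Types (z w a b : R[i]) (g l : R).

Lemma normc_sqrtE z : normc z = Num.sqrt (complex.Re z ^+ 2 + complex.Im z ^+ 2).
Proof. by case: z. Qed.

Lemma normc_ge0 z : 0 <= normc z.
Proof. by rewrite normc_sqrtE sqrtr_ge0. Qed.

Lemma normc_sqr z : normc z ^+ 2 = complex.Re z ^+ 2 + complex.Im z ^+ 2.
Proof. by rewrite normc_sqrtE sqr_sqrtr// addr_ge0 ?sqr_ge0. Qed.

Lemma normr_Re_le z : `|complex.Re z| <= normc z.
Proof. by rewrite normc_sqrtE -sqrtr_sqr ler_sqrt ?lerDl ?addr_ge0 ?sqr_ge0. Qed.

Lemma normr_Im_le z : `|complex.Im z| <= normc z.
Proof. by rewrite normc_sqrtE -sqrtr_sqr ler_sqrt ?lerDr ?addr_ge0 ?sqr_ge0. Qed.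

Lemma Re_le_normc z : complex.Re z <= normc z.
Proof. exact: le_trans (ler_norm _) (normr_Re_le z). Qed.

Lemma normc_real_complex (x : R) : 0 <= x -> normc x%:C = x.
Proof. by move=> x0; rewrite normc_sqrtE/= expr0n addr0 sqrtr_sqr ger0_norm. Qed.

Lemma Re_mulc z w : complex.Re (z * w) =
  complex.Re z * complex.Re w - complex.Im z * complex.Im w.
Proof. by case: z w => [? ?] [? ?]. Qed.

Lemma Im_mulc z w : complex.Im (z * w) =
  complex.Re z * complex.Im w + complex.Im z * complex.Re w.
Proof. by case: z w => [? ?] [? ?]. Qed.

Lemma Re_subc z w : complex.Re (z - w) = complex.Re z - complex.Re w.
Proof. by case: z w => [? ?] [? ?]. Qed.

Lemma Im_subc z w : complex.Im (z - w) = complex.Im z - complex.Im w.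
Proof. by case: z w => [? ?] [? ?]. Qed.

Lemma normc_cexp z : normc (cexp z) = expR (complex.Re z).
Proof.
rewrite normc_sqrtE/= !exprMn -mulrDr cos2Dsin2 mulr1 sqrtr_sqr ger0_norm// expR_ge0.
Qed.

Lemma cexpD z w : cexp (z + w) = cexp z * cexp w.
Proof.
case: z w => [x y] [x' y']; apply/eqP; rewrite eq_complex/= expRD cosD sinD.
by apply/andP; split; apply/eqP; ring.
Qed.

Lemma cexp0 : cexp 0 = 1 :> R[i].
Proof. by apply/eqP; rewrite eq_complex /= expR0 cos0 sin0 mulr1 mulr0 !eqxx. Qed.

Lemma cexp_sub1_le z : normc z <= 1 / 3 -> normc (cexp z - 1) <= 9 / 7 * normc z.
Proof.
move=> hz; rewrite -ler_sqr ?nnegrE ?mulr_ge0 ?normc_ge0// exprMn.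
rewrite !normc_sqr Re_subc Im_subc/= subr0.
set x := complex.Re z; set y := complex.Im z.
have hx : `|x| <= 1 / 3 by exact: le_trans (normr_Re_le z) hz.
have := expR_sub1_sqr_le hx; have := cos_ge_quadratic y.
have h0 := expR_ge0 x; have := cos2Dsin2 y.
(* With this, 2 exp(x) (1 - cos y) is at most 3/2 y^2, and 3/2 < (9/7)^2. *)
have : expR x <= 3 / 2.
  have := ler_norm x; have := @expR_sub1_le _ `|x|; rewrite normr_ge0 hx.
  move=> /(_ isT); have : expR x <= expR `|x| by rewrite ler_expR ler_norm.
  by lra.
move=> h1 h2 h3 h4.
have -> : (expR x * cos y - 1) ^+ 2 + (expR x * sin y) ^+ 2 =
   (expR x - 1) ^+ 2 + 2 * expR x * (1 - cos y) + expR x ^+ 2 * (cos y ^+ 2 + sin y ^+ 2 - 1).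
  by ring.
rewrite h2 subrr mulr0 addr0 [leRHS]mulrDr lerD//.
have := sqr_ge0 y; nra.
Qed.

Lemma normc_rotate z : exists2 u : R[i], normc u = 1 & u * z = (normc z)%:C.
Proof.
have [->|z0] := eqVneq z 0.
  by exists 1; rewrite ?normc1// normc0 mulr0.
have nz0 : normc z != 0 by apply: contra z0 => /eqP/eq0_normc ->.
exists ((normc z)%:C / z); last by rewrite divfK.
by rewrite normcM normcV normc_real_complex ?normc_ge0// divff.
Qed.

Lemma Re_unit_mul_le u z : normc u = 1 -> complex.Re (u * z) <= normc z.
Proof. by move=> u1; rewrite -[leRHS]mul1r -u1 -normcM; exact: Re_le_normc. Qed.

(* [b / a] has an argument in [-g, g], or [a = b = 0]. *)
Definition angle_le g a b :=
  exists2 w : R[i], `|complex.Im w| <= g & b = a * cexp w.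

Lemma angle_le_refl a : angle_le 0 a a.
Proof. by exists 0; rewrite ?normr0// cexp0 mulr1. Qed.

Lemma angle_le_trans g g' a b c :
  angle_le g a b -> angle_le g' b c -> angle_le (g + g') a c.
Proof.
move=> [w hw ->] [w' hw' ->]; exists (w + w'); last by rewrite cexpD mulrA.
apply: le_trans (lerD hw hw'); apply: le_trans (ler_normD _ _).
by case: w w' {hw hw'} => [? ?] [? ?].
Qed.

Lemma angle_le_weaken g g' a b : g <= g' -> angle_le g a b -> angle_le g' a b.
Proof. by move=> gg' [w hw ->]; exists w => //; exact: le_trans gg'. Qed.

(** The rotation [u] brings [a] to the nonnegative real axis, so [u * b] has argument [complex.Im w]
    within [g] of 0. The cosine is even and decreasing on [0, pi]. *)
Lemma angle_le_Re g u a b : g <= pi -> u * a = (normc a)%:C ->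
  angle_le g a b -> cos g * normc b <= complex.Re (u * b).
Proof.
move=> gpi ua [w hw ->]; rewrite mulrA ua Re_mulc/= mul0r subr0 normcM normc_cexp.
rewrite mulrC -!mulrA ler_wpM2l ?normc_ge0// ler_wpM2l ?expR_ge0//.
have h0 := normr_ge0 (complex.Im w); rewrite -[leRHS]cos_norm.
by rewrite leNgt ltr_cos -?leNgt// in_itv/=; lra.
Qed.

(* 81/49 = (9/7)^2: one factor bounds |exp z - 1|, the other the loss of modulus. *)
Lemma angle_le_addr l a e : 0 <= l <= 1 / 3 ->
  normc e <= 81 / 49 * l * normc a -> angle_le (2 * l) a (a + e).
Proof.
move=> /andP[l0 l1] he.
have [a0|a0] := eqVneq a 0.
  exists 0; first by rewrite normr0 mulr_ge0.
  move: he; rewrite a0 normc0 mulr0 => he.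
  by rewrite mul0r add0r; apply: eq0_normc; apply/eqP; rewrite eq_le he normc_ge0.
have na0 : 0 < normc a.
  by rewrite lt_def normc_ge0 andbT; apply: contra a0 => /eqP/eq0_normc ->.
pose z := e / a.
have hz : normc z <= 81 / 49 * l by rewrite normcM normcV ler_pdivrMr.
have -> : a + e = a * (1 + z) by rewrite mulrDr mulr1 mulrC divfK.
have hz2 : complex.Re z ^+ 2 + complex.Im z ^+ 2 <= (81 / 49 * l) ^+ 2.
  by rewrite -normc_sqr lerXn2r// ?nnegrE ?normc_ge0//; lra.
have zE : 1 + z = (1 + complex.Re z) +i* complex.Im z.
  by case: (z) => ? ?; apply/eqP; rewrite eq_complex/= add0r !eqxx.
have hzx := normr_Re_le z; rewrite zE.
move: (complex.Re z) (complex.Im z) hzx hz2 => x y hzx hz2.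
have x1 : 0 < 1 + x by move: hzx; rewrite ler_norml => /andP[]; lra.
have n0 : 0 < 1 + (y / (1 + x)) ^+ 2 by have := sqr_ge0 (y / (1 + x)); lra.
set t := y / (1 + x) in n0 *.
(* An explicit logarithm of 1 + z, which lies in the right half plane: the first component is the
   logarithm of its modulus, [atan t] is its argument. *)
exists (ln ((1 + x) * Num.sqrt (1 + t ^+ 2)) +i* atan t) => /=.
  have hl : 0 <= 2 * l by lra.
  rewrite -ler_sqr ?nnegrE// real_normK ?num_real//; apply: le_trans (atan_sqr_le t) _.
  rewrite expr_div_n ler_pdivrMr ?exprn_gt0//.
  (* The difference is quadratic in [x] with leading coefficient 1 + 4 l^2; multiplying by that
     coefficient completes the square below. The remainder is nonnegative because l^2 <= 1/9. *)
  suff : 0 <= (1 + 4 * l ^+ 2) * ((2 * l) ^+ 2 * (1 + x) ^+ 2 - ((81 / 49 * l) ^+ 2 - x ^+ 2)).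
    by rewrite pmulr_rge0; [lra|have := sqr_ge0 l; lra].
  have l9 : l ^+ 2 <= 1 / 9 by nra.
  have -> : (1 + 4 * l ^+ 2) * ((2 * l) ^+ 2 * (1 + x) ^+ 2 - ((81 / 49 * l) ^+ 2 - x ^+ 2)) =
      ((1 + 4 * l ^+ 2) * x + 4 * l ^+ 2) ^+ 2 +
      l ^+ 2 * ((1 + 4 * l ^+ 2) * (4 - (81 / 49) ^+ 2) - 16 * l ^+ 2) by field.
  rewrite addr_ge0 ?sqr_ge0// mulr_ge0 ?sqr_ge0//; lra.
have s0 : 0 < Num.sqrt (1 + t ^+ 2) by rewrite sqrtr_gt0.
congr (_ * _); apply/eqP; rewrite eq_complex/= lnK ?posrE ?mulr_gt0// cos_atan.
have ct : cos (atan t) != 0 by rewrite cos_atan invr_neq0// gt_eqF.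
have -> : sin (atan t) = t * cos (atan t).
  by rewrite -[X in X * _](atanK t) /tan divfK.
rewrite cos_atan; apply/andP; split; apply/eqP.
  by rewrite mulfK// gt_eqF.
by rewrite mulrCA !mulrA mulfK ?gt_eqF// /t divfK// gt_eqF.
Qed.

Lemma normc_sum_le (I : Type) (s : seq I) (F : I -> R[i]) (M : R) :
  (forall i, normc (F i) <= M) -> normc (\sum_(i <- s) F i) <= (size s)%:R * M.
Proof.
move=> FM; elim: s => [|i s IH]; first by rewrite big_nil normc0 mul0r.
rewrite big_cons/= -add1n natrD mulrDl mul1r.
exact: le_trans (le_normcD _ _) (lerD _ _).
Qed.
End complex_estimates.

(** * Changing one coordinate of a point *)

Section coordinate_update.
Context n (d : 'I_n -> measure_display) (T : forall i, measurableType (d i)).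
Implicit Types (x y : prod_space T) (i j k : 'I_n).

Definition upd x j (t : T j) : prod_space T := eqtype.dfwith x t.

Lemma upd_eq x j (t : T j) : upd x t j = t.
Proof. exact: eqtype.dfwith_in. Qed.

Lemma upd_neq x j (t : T j) k : j != k -> upd x t k = x k.
Proof. exact: eqtype.dfwith_out. Qed.

Lemma upd_id x j : upd x (x j) = x.
Proof.
by apply: functional_extensionality_dep => k; have [<-|jk] := eqVneq j k; rewrite ?upd_eq ?upd_neq.
Qed.

Lemma upd_upd x j (s t : T j) : upd (upd x s) t = upd x t.
Proof.
by apply: functional_extensionality_dep => k; have [<-|jk] := eqVneq j k; rewrite ?upd_eq ?upd_neq.
Qed.

Lemma updC x i j (s : T i) (t : T j) : i != j ->
  upd (upd x s) t = upd (upd x t) s.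
Proof.
move=> ij; apply: functional_extensionality_dep => k.
have [jk|jk] := eqVneq j k.
  by case: _ / jk; rewrite upd_eq upd_neq// upd_eq.
have [ik|ik] := eqVneq i k; last by rewrite !upd_neq.
by case: _ / ik jk => ji; rewrite upd_eq upd_neq// upd_eq.
Qed.

Lemma measurable_upd j :
  measurable_fun setT (fun u : prod_space T * T j => upd u.1 u.2).
Proof.
apply: measurable_to_prod_space => k.
have [jk|jk] := eqVneq j k.
  case: _ / jk.
  under eq_fun do rewrite upd_eq.
  exact: measurable_snd.
under eq_fun do rewrite upd_neq//.
apply: (measurableT_comp (f := fun x : prod_space T => x k)) => //.
exact: measurable_coord.
Qed.

Lemma measurable_upd2 x j : measurable_fun setT (fun t : T j => upd x t).
Proof. exact: (measurable_fun_pair2 x (@measurable_upd j)). Qed.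

End coordinate_update.

(** * Bounded measurable real and complex functions *)

(** Unlike integrability, which Fubini's theorem passes on to almost every slice only, this class is
    kept by every slice. *)
Definition bounded_measurable {R : realType} {dX} {X : measurableType dX}
    (f : X -> R) :=
  measurable_fun setT f /\ exists M : R, forall x, `|f x| <= M.

Section bounded_measurable.
Context {R : realType} {dX} {X : measurableType dX}.
Implicit Types (f g : X -> R) (F G : X -> R[i]).

Lemma bounded_measurableD f g : bounded_measurable f -> bounded_measurable g ->
  bounded_measurable (fun x => f x + g x).
Proof.
move=> [mf [M fM]] [mg [N gN]]; split; first exact: measurable_funD.
by exists (M + N) => x; exact: le_trans (ler_normD _ _) (lerD _ _).
Qed.

Lemma bounded_measurableM f g : bounded_measurable f -> bounded_measurable g ->
  bounded_measurable (fun x => f x * g x).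
Proof.
move=> [mf [M fM]] [mg [N gN]]; split; first exact: measurable_funM.
by exists (M * N) => x; rewrite normrM ler_pM.
Qed.

Lemma bounded_measurable_cst (a : R) : bounded_measurable (fun _ : X => a).
Proof. by split; [exact: measurable_cst|exists `|a|]. Qed.

Lemma bounded_measurableB f g : bounded_measurable f -> bounded_measurable g ->
  bounded_measurable (fun x => f x - g x).
Proof.
move=> bf bg; have bNg := bounded_measurableM (bounded_measurable_cst (-1)) bg.
have := bounded_measurableD bf bNg.
by congr bounded_measurable; apply/funext => x; rewrite mulN1r.
Qed.

Lemma bounded_measurable_integrable (mu : probability X R) f :
  bounded_measurable f -> mu.-integrable setT (EFin \o f).
Proof.
move=> [mf [M fM]]; apply: measurable_bounded_integrable => //.
  exact: le_lt_trans (probability_le1 mu measurableT) (ltry 1).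
exists M; split => [|r Mr x _]; [exact: num_real|exact: le_trans (fM x) (ltW Mr)].
Qed.

Lemma bounded_measurable_comp dY (Y : measurableType dY) (g : Y -> X) f :
  bounded_measurable f -> measurable_fun setT g -> bounded_measurable (f \o g).
Proof.
by move=> [mf [M fM]] mg; split; [exact: measurableT_comp|exists M => x; exact: fM].
Qed.

Definition cbounded_measurable F :=
  bounded_measurable (fun x => complex.Re (F x)) /\
  bounded_measurable (fun x => complex.Im (F x)).

Lemma cbounded_measurableM F G : cbounded_measurable F -> cbounded_measurable G ->
  cbounded_measurable (fun x => F x * G x).
Proof.
move=> [FR FI] [GR GI]; split.
  under eq_fun do rewrite Re_mulc.
  by apply: bounded_measurableB; exact: bounded_measurableM.
under eq_fun do rewrite Im_mulc.
by apply: bounded_measurableD; exact: bounded_measurableM.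
Qed.

Lemma cbounded_measurable_cst (a : R[i]) : cbounded_measurable (fun _ : X => a).
Proof. by split; exact: bounded_measurable_cst. Qed.

Lemma cbounded_measurableD F G : cbounded_measurable F -> cbounded_measurable G ->
  cbounded_measurable (fun x => F x + G x).
Proof.
move=> [FR FI] [GR GI]; split.
  have -> : (fun x => complex.Re (F x + G x)) = (fun x => complex.Re (F x) + complex.Re (G x)).
    by apply/funext => x; case: (F x) (G x) => [? ?] [? ?].
  exact: bounded_measurableD.
have -> : (fun x => complex.Im (F x + G x)) = (fun x => complex.Im (F x) + complex.Im (G x)).
  by apply/funext => x; case: (F x) (G x) => [? ?] [? ?].
exact: bounded_measurableD.
Qed.

Lemma cbounded_measurable_normc F :
  cbounded_measurable F -> bounded_measurable (fun x => normc (F x)).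
Proof.
move=> [[mR [M RM]] [mI [N IN]]].
have E : (fun x => normc (F x)) =
    (fun x => Num.sqrt (complex.Re (F x) * complex.Re (F x) + complex.Im (F x) * complex.Im (F x))).
  by apply/funext => x; rewrite normc_sqrtE !expr2.
split.
  rewrite E; apply: (measurableT_comp (f := @Num.sqrt R)).
    by apply: continuous_measurable_fun; exact: sqrt_continuous.
  by apply: measurable_funD; exact: measurable_funM.
exists (M + N) => x; rewrite ger0_norm ?normc_ge0//.
apply: le_trans (lerD (RM x) (IN x)).
rewrite -ler_sqr ?nnegrE ?normc_ge0 ?addr_ge0// normc_sqr sqrrD.
by rewrite !real_normK ?num_real// lerD2r lerDl mulrn_wge0// mulr_ge0.
Qed.

Lemma cbounded_measurable_cexp F : cbounded_measurable F ->
  cbounded_measurable (fun x => cexp (F x)).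
Proof.
move=> [[mR [M RM]] [mI [N IN]]].
have bm_exp : bounded_measurable (fun x => expR (complex.Re (F x))).
  split; first exact: measurableT_comp.
  exists (expR M) => x; rewrite ger0_norm ?expR_ge0// ler_expR.
  exact: le_trans (ler_norm _) _.
split; apply: bounded_measurableM => //=; split.
- apply: (measurableT_comp (f := @cos R)) => //.
  by apply: continuous_measurable_fun; exact: continuous_cos.
- by exists 1 => x; exact: cos_max.
- apply: (measurableT_comp (f := @sin R)) => //.
  by apply: continuous_measurable_fun; exact: continuous_sin.
- by exists 1 => x; exact: sin_max.
Qed.

Lemma cbounded_measurable_sum (I : Type) (s : seq I) (F : I -> X -> R[i]) :
  (forall i, cbounded_measurable (F i)) ->
  cbounded_measurable (fun x => \sum_(i <- s) F i x).
Proof.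
move=> mF; elim: s => [|i s IH].
  by under eq_fun do rewrite big_nil; exact: cbounded_measurable_cst.
under eq_fun do rewrite big_cons.
exact: cbounded_measurableD.
Qed.

End bounded_measurable.

(** * Averaging over coordinates one at a time *)

Section averages.
Context {R : realType} {n : nat} {d : 'I_n -> measure_display}
  {T : forall i, measurableType (d i)} (P : forall i, probability (T i) R).
Implicit Types (x y : prod_space T) (i j : 'I_n) (s : seq 'I_n).
Implicit Types (f g : prod_space T -> R) (F G : prod_space T -> R[i]).

(** The average is still a function on the whole product, constant in coordinate [j], so averages
    over different coordinates compose and can be permuted without a change of type. *)
Definition avg j f x : R := \int[P j]_t f (upd x t).

Let slice_integrable j f x : bounded_measurable f ->
  (P j).-integrable setT (EFin \o (fun t : T j => f (upd x t))).
Proof.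
move=> bf; apply: bounded_measurable_integrable.
by apply: bounded_measurable_comp bf _; exact: measurable_upd2.
Qed.

Lemma avg_cst j f x (a : R) : (forall t : T j, f (upd x t) = a) -> avg j f x = a.
Proof.
move=> fa; rewrite /avg (_ : (fun t => _) = cst a); last exact/funext.
rewrite Rintegral_cst// -[RHS]mulr1; congr (_ * _).
exact: (congr1 fine (probability_setT (P j))).
Qed.

Lemma le_avg j f g x : bounded_measurable f -> bounded_measurable g ->
  (forall t : T j, f (upd x t) <= g (upd x t)) -> avg j f x <= avg j g x.
Proof. by move=> bf bg fg; apply: le_Rintegral => //; exact: slice_integrable. Qed.

Lemma avgD j f g x : bounded_measurable f -> bounded_measurable g ->
  avg j (fun y => f y + g y) x = avg j f x + avg j g x.
Proof. by move=> bf bg; apply: RintegralD => //; exact: slice_integrable. Qed.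

Lemma avgB j f g x : bounded_measurable f -> bounded_measurable g ->
  avg j (fun y => f y - g y) x = avg j f x - avg j g x.
Proof. by move=> bf bg; apply: RintegralB => //; exact: slice_integrable. Qed.

Lemma avgZ j f g x : bounded_measurable f ->
  (forall t : T j, g (upd x t) = g x) ->
  avg j (fun y => g y * f y) x = g x * avg j f x.
Proof.
move=> bf gx; rewrite /avg -RintegralZl//; last exact: slice_integrable.
by apply: eq_Rintegral => t _; rewrite gx.
Qed.

Lemma bounded_measurable_avg j f :
  bounded_measurable f -> bounded_measurable (avg j f).
Proof.
move=> bf; have [mf [M fM]] := bf; split.
  (* Any probability on the first factor would do: Fubini's theorem then yields measurability of the
     partial integral. *)
  have if2 : (prod_probability P \x P j)%E.-integrable setT
      (EFin \o (fun u : prod_space T * T j => f (upd u.1 u.2))).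
    apply: bounded_measurable_integrable.
    by apply: bounded_measurable_comp bf _; exact: measurable_upd.
  have := measurable_fubini_F if2.
  exact: measurableT_comp (fine_measurable measurableT).
exists M => x; rewrite ler_norml; apply/andP; split.
  rewrite -[leLHS](@avg_cst j (cst (- M)) x)//.
  apply: le_avg => // [|t]; first exact: bounded_measurable_cst.
  by move: (fM (upd x t)); rewrite ler_norml => /andP[].
rewrite -[leRHS](@avg_cst j (cst M) x)//.
apply: le_avg => // [|t]; first exact: bounded_measurable_cst.
exact: le_trans (ler_norm _) (fM _).
Qed.

Lemma avg_upd_neq i j f x (s : T i) : i != j ->
  avg j f (upd x s) = avg j (fun y => f (upd y s)) x.
Proof. by move=> ij; apply: eq_Rintegral => t _; rewrite updC. Qed.

Lemma avgC i j f : bounded_measurable f -> avg i (avg j f) = avg j (avg i f).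
Proof.
have [->//|ij] := eqVneq i j; move=> bf; apply/funext => x.
have bf2 : bounded_measurable (fun u : T i * T j => f (upd (upd x u.1) u.2)).
  apply: (bounded_measurable_comp (g := fun u : T i * T j => upd (upd x u.1) u.2) bf).
  apply: (measurableT_comp (f := fun v : prod_space T * T j => upd v.1 v.2)
    (g := fun u : T i * T j => (upd x u.1, u.2))).
    exact: measurable_upd.
  apply: measurable_fun_pair => //.
  by apply: measurableT_comp => //; exact: measurable_upd2.
have /Fubini : (P i \x P j)%E.-integrable setT
    (EFin \o (fun u : T i * T j => f (upd (upd x u.1) u.2))).
  exact: bounded_measurable_integrable.
rewrite /= => Fub; rewrite /avg /Rintegral.
transitivity (fine (\int[P i]_s \int[P j]_t (f (upd (upd x s) t))%:E)%E).
  congr fine; apply: eq_integral => s _; rewrite fineK//.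
  exact/integrable_fin_num/slice_integrable.
rewrite Fub; congr fine; apply: eq_integral => t _.
rewrite fineK; last exact/integrable_fin_num/slice_integrable.
by apply: eq_integral => s _; rewrite updC.
Qed.

(** The fold integrates the last coordinate of [s] first; a suffix of [s] is thus a set of
    coordinates already integrated. *)
Definition avgs s f := foldr avg f s.

Lemma bounded_measurable_avgs s f :
  bounded_measurable f -> bounded_measurable (avgs s f).
Proof. by move=> bf; elim: s => //= j s; exact: bounded_measurable_avg. Qed.

Lemma le_avgs s f g x : bounded_measurable f -> bounded_measurable g ->
  (forall y, f y <= g y) -> avgs s f x <= avgs s g x.
Proof.
move=> bf bg fg; elim: s x => //= j s IH x.
by apply: le_avg => //; exact: bounded_measurable_avgs.
Qed.

Lemma avgs_cst s (a : R) x : avgs s (fun=> a) x = a.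
Proof. by elim: s x => //= j s IH x; exact: avg_cst. Qed.

Lemma avgsZ s f (a : R) x : bounded_measurable f ->
  avgs s (fun y => a * f y) x = a * avgs s f x.
Proof.
move=> bf; elim: s x => //= j s IH x.
rewrite (_ : avgs s _ = (fun y => a * avgs s f y)); last exact/funext.
rewrite (avgZ (g := fun=> a))//.
exact: bounded_measurable_avgs.
Qed.

Definition cavg j F x : R[i] :=
  avg j (fun y => complex.Re (F y)) x +i* avg j (fun y => complex.Im (F y)) x.

Lemma cbounded_measurable_cavg j F :
  cbounded_measurable F -> cbounded_measurable (cavg j F).
Proof. by move=> [? ?]; split; exact: bounded_measurable_avg. Qed.

Lemma cavgD j F G x : cbounded_measurable F -> cbounded_measurable G ->
  cavg j (fun y => F y + G y) x = cavg j F x + cavg j G x.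
Proof.
move=> [FR FI] [GR GI]; rewrite /cavg.
rewrite (_ : (fun y => complex.Re _) = fun y => complex.Re (F y) + complex.Re (G y)).
  rewrite (_ : (fun y => complex.Im (_ + _)) = fun y => complex.Im (F y) + complex.Im (G y)).
    by rewrite !avgD.
  by apply/funext => y; case: (F y) (G y) => [? ?] [? ?].
by apply/funext => y; case: (F y) (G y) => [? ?] [? ?].
Qed.

Lemma cavgZ j F G x : cbounded_measurable F ->
  (forall t : T j, G (upd x t) = G x) ->
  cavg j (fun y => G y * F y) x = G x * cavg j F x.
Proof.
move=> [FR FI] Gx.
have bM (a : R) f : bounded_measurable f -> bounded_measurable (fun y => a * f y).
  by move=> bf; apply: bounded_measurableM => //; exact: bounded_measurable_cst.
have aZ (a : R) f : bounded_measurable f -> avg j (fun y => a * f y) x = a * avg j f x.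
  by move=> bf; exact: (avgZ (g := fun=> a)).
apply/eqP; rewrite eq_complex Re_mulc Im_mulc /= -!aZ//.
rewrite -avgB -?avgD; try exact: bM.
by apply/andP; split; apply/eqP; apply: eq_Rintegral => t _;
  rewrite Gx ?Re_mulc ?Im_mulc.
Qed.

Lemma Re_mul_cavg j F x (u : R[i]) : cbounded_measurable F ->
  complex.Re (u * cavg j F x) = avg j (fun y => complex.Re (u * F y)) x.
Proof. by move=> bF; rewrite -(cavgZ (G := fun=> u)). Qed.

Lemma bounded_measurable_Re_mul (u : R[i]) F : cbounded_measurable F ->
  bounded_measurable (fun y => complex.Re (u * F y)).
Proof. by move=> bF; case: (cbounded_measurableM (cbounded_measurable_cst u) bF). Qed.

(** A rotation makes the average real and nonnegative; the real part of the rotated integrand is at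
    most its modulus. *)
Lemma normc_cavg_le j F x : cbounded_measurable F ->
  normc (cavg j F x) <= avg j (fun y => normc (F y)) x.
Proof.
move=> bF; have [u u1 uz] := normc_rotate (cavg j F x).
have -> : normc (cavg j F x) = complex.Re (u * cavg j F x) by rewrite uz.
rewrite Re_mul_cavg//; apply: le_avg => [| |t]; last exact: Re_unit_mul_le.
- exact: bounded_measurable_Re_mul.
- exact: cbounded_measurable_normc.
Qed.

(** Rotate so that [F x] becomes real and nonnegative. Every value on the line through [x] in
    direction [j] then has real part at least [cos a] times its modulus, and this integrates. *)
Lemma normc_cavg_ge j F x (a : R) : cbounded_measurable F -> a <= pi ->
  (forall t : T j, angle_le a (F x) (F (upd x t))) ->
  cos a * avg j (fun y => normc (F y)) x <= normc (cavg j F x).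
Proof.
move=> bF gpi ang; have [u u1 uz] := normc_rotate (F x).
apply: le_trans (Re_unit_mul_le (cavg j F x) u1).
rewrite -(avgZ (g := fun=> cos a))//; last exact: cbounded_measurable_normc.
rewrite Re_mul_cavg//; apply: le_avg => [| |t].
- apply: bounded_measurableM; first exact: bounded_measurable_cst.
  exact: cbounded_measurable_normc.
- exact: bounded_measurable_Re_mul.
- exact: angle_le_Re (ang t).
Qed.

Lemma cavgC i j F : cbounded_measurable F -> cavg i (cavg j F) = cavg j (cavg i F).
Proof.
move=> [FR FI]; apply/funext => x; rewrite /cavg /=.
by congr (_ +i* _); [have := avgC i j FR|have := avgC i j FI] => /(congr1 (@^~ x)).
Qed.

Lemma cavg_upd_neq i j F x (s : T i) : i != j ->
  cavg j F (upd x s) = cavg j (fun y => F (upd y s)) x.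
Proof. by move=> ij; rewrite /cavg !avg_upd_neq. Qed.

Definition cavgs s F := foldr cavg F s.

Lemma Re_cavgs s F x : complex.Re (cavgs s F x) = avgs s (fun y => complex.Re (F y)) x.
Proof. by elim: s x => //= j s IH x; apply: eq_Rintegral => t _. Qed.

Lemma Im_cavgs s F x : complex.Im (cavgs s F x) = avgs s (fun y => complex.Im (F y)) x.
Proof. by elim: s x => //= j s IH x; apply: eq_Rintegral => t _. Qed.

Lemma cavgs_cat s1 s2 F : cavgs (s1 ++ s2) F = cavgs s1 (cavgs s2 F).
Proof. exact: foldr_cat. Qed.

Lemma cbounded_measurable_cavgs s F :
  cbounded_measurable F -> cbounded_measurable (cavgs s F).
Proof. by move=> bF; elim: s => //= j s; exact: cbounded_measurable_cavg. Qed.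

Lemma cavgsD s F G : cbounded_measurable F -> cbounded_measurable G ->
  cavgs s (fun y => F y + G y) = (fun x => cavgs s F x + cavgs s G x).
Proof.
move=> bF bG; elim: s => //= j s ->; apply/funext => x.
by rewrite cavgD//; exact: cbounded_measurable_cavgs.
Qed.

Lemma cavgsZ s F G : cbounded_measurable F ->
  (forall j, j \in s -> forall x (t : T j), G (upd x t) = G x) ->
  cavgs s (fun y => G y * F y) = (fun x => G x * cavgs s F x).
Proof.
move=> bF; elim: s => //= j s IH Gs; rewrite IH; last first.
  by move=> i si; apply: Gs; rewrite inE si orbT.
apply/funext => x; rewrite cavgZ//; first exact: cbounded_measurable_cavgs.
by move=> t; apply: Gs; rewrite mem_head.
Qed.

Lemma normc_cavgs_le s F x : cbounded_measurable F ->
  normc (cavgs s F x) <= avgs s (fun y => normc (F y)) x.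
Proof.
move=> bF; elim: s x => //= j s IH x.
have bc := cbounded_measurable_cavgs s bF.
apply: le_trans (normc_cavg_le j x bc) _.
apply: le_avg => //; first exact: cbounded_measurable_normc.
exact/bounded_measurable_avgs/cbounded_measurable_normc.
Qed.

Lemma cavgs_upd s F x j (t : T j) : j \notin s ->
  cavgs s F (upd x t) = cavgs s (fun y => F (upd y t)) x.
Proof.
elim: s x => //= i s IH x; rewrite inE negb_or => /andP[ji js].
rewrite cavg_upd_neq//; congr cavg.
by apply/funext => y; exact: IH.
Qed.

Lemma cavgs_cavgC s j F : cbounded_measurable F ->
  cavgs s (cavg j F) = cavg j (cavgs s F).
Proof.
move=> bF; elim: s => //= i s ->.
by rewrite cavgC//; exact: cbounded_measurable_cavgs.
Qed.

(** Since averages commute, the coordinates outside [p] can be moved inside and integrated first. *)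
Lemma cavgs_filter (p : pred 'I_n) s F : cbounded_measurable F ->
  cavgs s F = cavgs [seq j <- s | p j] (cavgs [seq j <- s | ~~ p j] F).
Proof.
move=> bF; elim: s => //= j s IH; case: (p j) => /=; first by rewrite IH.
by rewrite cavgs_cavgC ?IH//; exact: cbounded_measurable_cavgs.
Qed.

(** Each integration costs one factor [cos a]. When the turn of [j] comes, exactly the suffix [s2]
    has been integrated, hence the angle condition on suffixes. *)
Lemma normc_cavgs_ge s F x (a : R) : 0 <= cos a -> a <= pi -> cbounded_measurable F ->
  (forall s1 j s2 y (t : T j), s = s1 ++ j :: s2 ->
     angle_le a (cavgs s2 F y) (cavgs s2 F (upd y t))) ->
  cos a ^+ size s * avgs s (fun y => normc (F y)) x <= normc (cavgs s F x).
Proof.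
move=> cg gpi bF; elim: s x => [|j s IH] x ang /=; first by rewrite expr0 mul1r.
have bc := cbounded_measurable_cavgs s bF.
have bn := cbounded_measurable_normc bc.
have ba : bounded_measurable (avgs s (fun y => normc (F y))).
  exact/bounded_measurable_avgs/cbounded_measurable_normc.
apply: le_trans (normc_cavg_ge bc gpi _); last by move=> t; exact: (ang [::]).
rewrite exprS -mulrA ler_wpM2l// -(avgZ (g := fun=> cos a ^+ size s))//.
apply: le_avg => //.
  by apply: bounded_measurableM => //; exact: bounded_measurable_cst.
move=> t; apply: IH => s1 i s2 y r sE; apply: (ang (j :: s1)).
by rewrite sE.
Qed.

End averages.

(** * The expectation as an iterated average *)

Section iterated_expectation.
Context {R : realType}.

Lemma cons_point_upd n (d : 'I_n.+1 -> measure_display)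
    (T : forall i, measurableType (d i)) (t : T ord0) y j (r : T (lift ord0 j)) :
  upd (cons_point (t, y)) r = cons_point (t, upd (T := fun i => T (lift ord0 i)) y (j := j) r).
Proof.
apply: functional_extensionality_dep => k; case: (unliftP ord0 k) => [i|] -> {k}.
  rewrite cons_pointS /=; have [ji|ji] := eqVneq j i.
    by subst i; rewrite !upd_eq.
  by rewrite !upd_neq ?cons_pointS.
by rewrite upd_neq ?cons_point0.
Qed.

Lemma cons_point_upd0 n (d : 'I_n.+1 -> measure_display)
    (T : forall i, measurableType (d i)) (x : prod_space T) (t : T ord0) :
  upd x t = cons_point (t, fun i => x (lift ord0 i)).
Proof.
apply: functional_extensionality_dep => k; case: (unliftP ord0 k) => [i|] -> {k}.
  by rewrite cons_pointS upd_neq.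
by rewrite cons_point0 upd_eq.
Qed.

Lemma avgs_cons_point n (d : 'I_n.+1 -> measure_display)
    (T : forall i, measurableType (d i)) (P : forall i, probability (T i) R)
    s (f : prod_space T -> R) t y :
  avgs P [seq lift ord0 j | j <- s] f (cons_point (t, y)) =
  avgs (fun i => P (lift ord0 i)) s (fun z => f (cons_point (t, z))) y.
Proof.
elim: s y => //= j s IH y; apply: eq_Rintegral => r _.
by rewrite cons_point_upd IH.
Qed.

(** Induction on [n]: the product measure is the image under [cons_point] of the first factor times
    the product of the others, and Fubini's theorem splits off coordinate 0. The right-hand side
    takes the same value at every [x], as all coordinates are averaged. *)
Lemma integral_prod_probability n (d : 'I_n -> measure_display)
    (T : forall i, measurableType (d i)) (P : forall i, probability (T i) R)
    (f : prod_space T -> R) x : bounded_measurable f ->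
  (\int[prod_probability P]_y (f y)%:E = (avgs P (enum 'I_n) f x)%:E)%E.
Proof.
elim: n d T P f x => [|n IH] d T P f x bf.
  have mf : measurable_fun setT (EFin \o f) by apply/measurable_EFinP; case: bf.
  rewrite /= integral_dirac// diracT mul1e (_ : enum 'I_0 = [::]).
    (* The empty product has a single point, so the Dirac mass evaluates [f] at [x]. *)
    by congr (f _)%:E; apply: functional_extensionality_dep; case.
  by apply: size0nil; rewrite size_enum_ord.
have mf : measurable_fun setT (EFin \o f) by apply/measurable_EFinP; case: bf.
set P' := fun i => P (lift ord0 i).
have bc : bounded_measurable (f \o @cons_point n d T).
  exact: bounded_measurable_comp bf (@measurable_cons_point n d T).
have ic : (P ord0 \x prod_probability P')%E.-integrable setT
    (EFin \o (f \o @cons_point n d T)).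
  exact: bounded_measurable_integrable.
rewrite /= integral_distribution//.
rewrite -(integral12_prod_meas1 ic) enum_ordSl /=.
set y := fun i : 'I_n => x (lift ord0 i).
rewrite /avg /Rintegral fineK; last first.
  apply: integrable_fin_num => //.
  apply: bounded_measurable_integrable.
  apply: (@bounded_measurable_comp _ _ _ _ _ (fun t : T ord0 => upd x t)
    (avgs P [seq lift ord0 j | j <- enum 'I_n] f)).
    exact: bounded_measurable_avgs.
  exact: measurable_upd2.
apply: eq_integral => t _; rewrite /fubini_F /=.
rewrite (IH _ _ P' (fun z => f (cons_point (t, z))) y).
  by rewrite cons_point_upd0 avgs_cons_point.
apply: (bounded_measurable_comp (g := fun z => (t, z)) bc).
exact: pair1_measurable.
Qed.

Lemma cexpectation_prod_probability n (d : 'I_n -> measure_display)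
    (T : forall i, measurableType (d i)) (P : forall i, probability (T i) R)
    (F : prod_space T -> R[i]) x : cbounded_measurable F ->
  cexpectation (prod_probability P) F = cavgs P (enum 'I_n) F x.
Proof.
move=> [FR FI]; apply/eqP; rewrite eq_complex Re_cavgs Im_cavgs /=.
rewrite unlock /expectation.body.
by rewrite !(integral_prod_probability P x) ?eqxx.
Qed.

End iterated_expectation.

(** * Induction on the set of integrated coordinates *)

Section angle_induction.
Context {R : realType} {n m : nat} {d : 'I_n -> measure_display}
  {T : forall i, measurableType (d i)} (P : forall i, probability (T i) R).
Context (r c : nat) (J : 'I_m -> {set 'I_n}) (lambda : R[i]).
Hypotheses (r2 : (2 <= r)%N) (c1 : (1 <= c)%N).
Hypothesis Jr : forall i, (#|J i| <= r)%N.
Hypothesis Jc : forall j : 'I_n, (#|[set i : 'I_m | j \in J i]%SET| <= c)%N.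
Hypothesis lambda_le : normc lambda <= 1 / (3 * c%:R * Num.sqrt (r%:R - 1)).
Implicit Types (x y : prod_space T) (phi : 'I_m -> prod_space T -> R[i]).
Implicit Types (s : seq 'I_n).

(** The Lipschitz and dependence conditions are phrased through updates of one coordinate, a form
    that passes to the hybrid families below. *)
Definition admissible phi := forall i,
  [/\ cbounded_measurable (phi i),
      forall x j (t : T j), normc (phi i (upd x t) - phi i x) <= 1 &
      forall j, j \notin J i -> forall x (t : T j), phi i (upd x t) = phi i x].

Definition weight phi y : R[i] := cexp (lambda * \sum_(i < m) phi i y).

Let q : R := Num.sqrt (r%:R - 1).
(** The angle allowed per coordinate: (r - 1) [gam]^2 = (2/3)^2, exactly what [cos_exp_ge] tolerates
    for r - 1 integrations. *)
Let gam : R := 2 / 3 / q.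

Let q1 : 1 <= q.
Proof.
rewrite /q -[leLHS]sqrtr1 ler_wsqrtr//.
have : (2 : R) <= r%:R by rewrite ler_nat.
lra.
Qed.

Let q_gt0 : 0 < q. Proof. exact: lt_le_trans ltr01 q1. Qed.

Let c1R : 1 <= c%:R :> R. Proof. by rewrite ler1n. Qed.

Lemma lambda_le_third : 0 <= normc lambda <= 1 / 3.
Proof.
rewrite normc_ge0; apply: le_trans lambda_le _.
have c0 : 0 < c%:R :> R by exact: lt_le_trans ltr01 c1R.
rewrite -/q !div1r lef_pV2 ?posrE ?mulr_gt0// -mulrA ler_peMr//.
by have := q1; have := c1R; nra.
Qed.

(** There is equality when |lambda| attains its bound: 2 c / (3 c q) = 2 / (3 q). *)
Lemma angle_budget : 2 * normc lambda * c%:R <= gam.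
Proof.
have c0 : 0 < c%:R :> R by exact: lt_le_trans ltr01 c1R.
rewrite -ler_pdivlMr// -ler_pdivlMl//; apply: le_trans lambda_le _.
rewrite /gam -/q le_eqVlt; apply/orP; left; apply/eqP; field.
by rewrite !gt_eqF.
Qed.

Lemma gam_bounds : 0 <= gam <= 2 / 3.
Proof.
by rewrite divr_ge0 ?(ltW q_gt0)//= ler_pdivrMr//; have := q1; lra.
Qed.

Lemma cos_gam_ge (k : nat) : (k < r)%N -> 7 / 9 <= cos gam ^+ k.
Proof.
move=> kr; have /andP[g0 g1] := gam_bounds; apply: cos_exp_ge => //.
rewrite /gam expr_div_n mulrCA ler_piMr ?sqr_ge0//.
have r2R : (2 : R) <= r%:R by rewrite ler_nat.
have kR : k%:R + 1 <= r%:R :> R by rewrite natr1 ler_nat.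
rewrite ler_pdivrMr ?exprn_gt0// mul1r /q sqr_sqrtr; lra.
Qed.

Lemma cos_gam_ge0 : 0 <= cos gam.
Proof. by apply: le_trans (_ : 7 / 9 <= _); [lra|have := @cos_gam_ge 1 r2; rewrite expr1]. Qed.

Lemma gam_le_pi : gam <= pi.
Proof. by have := gam_bounds; have := @pi_ge8_3 R; lra. Qed.

(** As 2/3 <= pi/4, the angle pi/(4q) is at least [gam]; it is also at most pi/2 because q >= 1. *)
Lemma cos_pi4_le : 0 <= cos (pi / (4 * q)) <= cos gam.
Proof.
have p := @pi_ge8_3 R; have /andP[g0 _] := gam_bounds; have gpi := gam_le_pi.
have gp4 : gam <= pi / (4 * q).
  by rewrite /gam ler_pdivrMr// invfM mulrA divfK ?gt_eqF//; lra.
have p4 : pi / (4 * q) <= pi / 2.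
  by rewrite ler_pdivrMr ?mulr_gt0//; have := q1; nra.
rewrite cos_ge0_pihalf/=; last by apply/andP; split; lra.
by rewrite leNgt ltr_cos -?leNgt// in_itv/=; lra.
Qed.

Lemma cbounded_measurable_weight phi : admissible phi ->
  cbounded_measurable (weight phi).
Proof.
move=> adm; apply: cbounded_measurable_cexp; apply: cbounded_measurableM.
  exact: cbounded_measurable_cst.
by apply: cbounded_measurable_sum => i; case: (adm i).
Qed.

(** The quantifier over all admissible families is inside, because the induction hypothesis is
    applied to hybrids of the given family. *)
Definition angle_bounded s := forall phi, admissible phi ->
  forall j, j \notin s -> forall x (t : T j),
  angle_le gam (cavgs P s (weight phi) x) (cavgs P s (weight phi) (upd x t)).

(* The coordinates of [s] outside [J i] are integrated first: [psi] does not
   see them, and the induction hypothesis controls the cancellation in the at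
   most [r - 1] remaining ones. *)
Lemma angle_perturbation s phi psi i j x :
  (forall s', (size s' < size s)%N -> uniq s' -> angle_bounded s') ->
  uniq s -> j \notin s -> j \in J i -> admissible phi ->
  cbounded_measurable psi -> (forall y, normc (psi y) <= 1) ->
  (forall k, k \notin J i -> forall y (t : T k), psi (upd y t) = psi y) ->
  angle_le (2 * normc lambda) (cavgs P s (weight phi) x)
    (cavgs P s (fun y => cexp (lambda * psi y) * weight phi y) x).
Proof.
move=> IH us js Jj adm bpsi psi1 psiJ.
have bw := cbounded_measurable_weight adm.
set s2 := [seq k <- s | k \in J i]; set s1 := [seq k <- s | k \notin J i].
pose h := cavgs P s1 (weight phi).
have bh : cbounded_measurable h by exact: cbounded_measurable_cavgs.
have bu : cbounded_measurable (fun y => cexp (lambda * psi y)).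
  apply/cbounded_measurable_cexp/cbounded_measurableM => //.
  exact: cbounded_measurable_cst.
have be : cbounded_measurable (fun y => (cexp (lambda * psi y) - 1) * h y).
  apply: cbounded_measurableM => //; apply: cbounded_measurableD => //.
  exact: cbounded_measurable_cst.
rewrite (cavgs_filter P (mem (J i)) s bw) -/s2 -/s1 -/h.
rewrite (cavgs_filter P (mem (J i)) s) -/s2 -/s1; last exact: cbounded_measurableM.
rewrite cavgsZ//; last first.
  by move=> k; rewrite mem_filter => /andP[kJ _] y t; rewrite psiJ.
(* The perturbed average becomes the original one plus an error term, the form that [angle_le_addr]
   handles. *)
have -> : (fun y => cexp (lambda * psi y) * cavgs P s1 (weight phi) y) =
    (fun y => h y + (cexp (lambda * psi y) - 1) * h y).
  by apply/funext => y; rewrite mulrBl mul1r addrC subrK.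
rewrite cavgsD//.
have uniq21 : uniq (s2 ++ s1) by rewrite (perm_uniq (permEl (perm_filterC (mem (J i)) s))).
have size21 : (size s2 + size s1 = size s)%N.
  by rewrite -size_cat (perm_size (permEl (perm_filterC (mem (J i)) s))).
(* Strict because [j] also belongs to [J i] but not to [s]. *)
have s2r : (size s2 < r)%N.
  apply: leq_trans (Jr i); rewrite cardE -[(size s2).+1]/(size (j :: s2)).
  apply: uniq_leq_size.
    by rewrite /= mem_filter (negbTE js) andbF filter_uniq.
  move=> k; rewrite inE mem_enum => /orP[/eqP -> //|].
  by rewrite mem_filter => /andP[].
have hn := cbounded_measurable_normc bh.
apply: angle_le_addr; first exact: lambda_le_third.
have cos_loss : 7 / 9 * avgs P s2 (fun y => normc (h y)) x <= normc (cavgs P s2 h x).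
  apply: le_trans (normc_cavgs_ge (a := gam) x cos_gam_ge0 gam_le_pi bh _).
    apply: ler_wpM2r; last exact: cos_gam_ge.
    rewrite -[leLHS](avgs_cst P s2 0 x); apply: le_avgs => //.
      exact: bounded_measurable_cst.
    by move=> y; exact: normc_ge0.
  (* Before [k] is integrated, the coordinates done are those of [b ++ s1], a list shorter than [s],
     so the induction hypothesis applies. *)
  move=> a k b y t s2E; rewrite /h -cavgs_cat.
  move: uniq21; rewrite s2E -catA cat_uniq => /and3P[_ _] /= /andP[kb ub].
  apply: IH => //.
  by rewrite -size21 s2E !size_cat /= addnS addSn ltnS leq_add2r leq_addl.
apply: le_trans (normc_cavgs_le P s2 x be) _.
apply: (@le_trans _ _ (avgs P s2 (fun y => 9 / 7 * normc lambda * normc (h y)) x)).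
  apply: le_avgs => [| |y].
  - exact: cbounded_measurable_normc.
  - by apply: bounded_measurableM => //; exact: bounded_measurable_cst.
  rewrite normcM ler_wpM2r ?normc_ge0//.
  have lpsi : normc (lambda * psi y) <= normc lambda.
    by rewrite normcM ler_piMr ?normc_ge0.
  have /andP[_ l3] := lambda_le_third.
  apply: le_trans (cexp_sub1_le (le_trans lpsi l3)) _.
  by rewrite ler_wpM2l.
(* The factor 9/7 |lambda| of the perturbation meets the inverse of the 7/9 in [cos_loss], which
   gives 81/49 |lambda|. *)
rewrite avgsZ//; have := normc_ge0 lambda; nra.
Qed.

(** Interpolates between [phi] and its update at coordinate [j]: the functions with index in [B]
    already see the new value [t]. *)
Definition hybrid phi j (t : T j) (B : seq 'I_m) i y : R[i] :=
  if i \in B then phi i (upd y t) else phi i y.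

(** An update at [k] different from [j] commutes with the one at [j]; an update at [j] itself is
    overwritten and changes nothing. *)
Lemma admissible_hybrid phi j (t : T j) B :
  admissible phi -> admissible (hybrid phi t B).
Proof.
move=> adm i; have [bm lip dep] := adm i; rewrite /hybrid; case: (i \in B) => //.
split=> [|x k u|k kJ x u].
- case: bm => bR bI.
  have mt : measurable_fun setT (fun y => upd y t).
    exact: measurable_fun_pair1 (@measurable_upd _ _ T j).
  by split; [exact: bounded_measurable_comp bR mt|exact: bounded_measurable_comp bI mt].
- have [kj|kj] := eqVneq k j; last by rewrite updC.
  by subst k; rewrite !upd_upd subrr normc0.
- have [kj|kj] := eqVneq k j; last by rewrite updC// dep.
  by subst k; rewrite !upd_upd.
Qed.

(** The functions are switched one by one and the angles add up. A function with [j] outside [J i]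
    is unchanged by the switch and costs nothing. *)
Lemma angle_hybrid s phi j (t : T j) x (B : seq 'I_m) :
  (forall s', (size s' < size s)%N -> uniq s' -> angle_bounded s') ->
  uniq s -> j \notin s -> admissible phi -> uniq B ->
  angle_le (2 * normc lambda * (count (fun i => j \in J i) B)%:R)
    (cavgs P s (weight phi) x) (cavgs P s (weight (hybrid phi t B)) x).
Proof.
move=> IH us js adm; elim: B => [_|i B IHB /= /andP[iB uB]].
  by rewrite mulr0 /hybrid; exact: angle_le_refl.
have [bm lip dep] := adm i.
(* The increment caused by switching function [i]: its modulus is at most 1 by the Lipschitz
   condition, and it depends only on coordinates in [J i]. *)
pose psi y := phi i (upd y t) - phi i y.
have wE : weight (hybrid phi t (i :: B)) =
    (fun y => cexp (lambda * psi y) * weight (hybrid phi t B) y).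
  apply/funext => y; rewrite /weight -cexpD -mulrDr; congr (cexp (_ * _)).
  rewrite (bigD1 i)// [in RHS](bigD1 i)//= addrA.
  rewrite /hybrid mem_head (negbTE iB) /psi subrK; congr (_ + _).
  by apply: eq_bigr => k ki; rewrite inE (negbTE ki).
rewrite addnC natrD mulrDr; apply: angle_le_trans (IHB uB) _; rewrite wE.
have [Jj|Jj] := boolP (j \in J i); last first.
  rewrite mulr0 (_ : (fun y => _) = weight (hybrid phi t B)).
    exact: angle_le_refl.
  by apply/funext => y; rewrite /psi dep// subrr mulr0 cexp0 mul1r.
rewrite mulr1; apply: (@angle_perturbation _ _ psi i j) => //.
- exact: admissible_hybrid.
- have [] := @admissible_hybrid phi j t [:: i] adm i.
  rewrite /hybrid mem_head => bt _ _; apply: cbounded_measurableD => //.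
  rewrite (_ : (fun y => - _) = (fun y => (-1) * phi i y)).
    by apply: cbounded_measurableM => //; exact: cbounded_measurable_cst.
  by apply/funext => y; rewrite mulN1r.
- by move=> y; exact: lip.
- move=> k kJ y u; rewrite /psi updC ?(dep k kJ)//.
  by apply: contraNneq kJ => ->.
Qed.

(** Strong induction on the size of [s]. As [j] is not in [s], its change passes under the averages
    and amounts to switching all functions; at most [c] of the switches count, and [angle_budget]
    closes the induction. *)
Lemma angle_boundedP s : uniq s -> angle_bounded s.
Proof.
have [N] := ubnP (size s); elim: N s => // N IHN s /ltnSE sN us.
move=> phi adm j js x t.
have IH s' : (size s' < size s)%N -> uniq s' -> angle_bounded s'.
  by move=> s's; apply: IHN; exact: leq_trans s's sN.
rewrite cavgs_upd//.
have -> : (fun y => weight phi (upd y t)) = weight (hybrid phi t (enum 'I_m)).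
  apply/funext => y; congr (cexp (_ * _)); apply: eq_bigr => i _.
  by rewrite /hybrid mem_enum.
apply: angle_le_weaken (angle_hybrid t x IH us js adm (enum_uniq _)).
apply: le_trans angle_budget; rewrite ler_wpM2l ?mulr_ge0 ?normc_ge0// ler_nat.
apply: leq_trans (Jc j); rewrite cardE -size_filter.
apply: uniq_leq_size => [|i]; first by rewrite filter_uniq// enum_uniq.
by rewrite mem_filter !mem_enum !inE => /andP[].
Qed.

(** The modulus of the integrand lies between exp(-|lambda| M) and exp(|lambda| M); the lower bound
    loses a further [cos gam] for each of the [n] integrations. *)
Lemma normc_expectation_ge phi (M : R) : admissible phi ->
  (forall y, normc (\sum_(i < m) phi i y) <= M) ->
  expR (- (normc lambda * M)) * cos gam ^+ n <=
    normc (cexpectation (prod_probability P) (weight phi)) <=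
  expR (normc lambda * M).
Proof.
move=> adm phiM; have bw := cbounded_measurable_weight adm.
have bn := cbounded_measurable_normc bw.
rewrite (cexpectation_prod_probability P point bw).
have wM y : expR (- (normc lambda * M)) <= normc (weight phi y) <= expR (normc lambda * M).
  rewrite normc_cexp !ler_expR -ler_norml.
  apply: le_trans (normr_Re_le _) _.
  by rewrite normcM ler_wpM2l ?normc_ge0.
apply/andP; split.
  apply: le_trans (normc_cavgs_ge (a := gam) _ cos_gam_ge0 gam_le_pi bw _).
    rewrite size_enum_ord mulrC ler_wpM2l ?exprn_ge0 ?cos_gam_ge0//.
    rewrite -[leLHS](avgs_cst P (enum 'I_n) _ point); apply: le_avgs => //.
      exact: bounded_measurable_cst.
    by move=> y; case/andP: (wM y).
  move=> s1 j s2 y t sE; have := enum_uniq 'I_n.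
  rewrite sE cat_uniq => /and3P[_ _] /= /andP[js2 us2].
  exact: angle_boundedP.
apply: le_trans (normc_cavgs_le _ _ _ bw) _.
rewrite -[leRHS](avgs_cst P (enum 'I_n) _ point); apply: le_avgs => //.
  exact: bounded_measurable_cst.
by move=> y; case/andP: (wM y).
Qed.

End angle_induction.

(** * Borel measurability on the complex plane and Lipschitz functions in the Hamming metric *)

Section hamming_lipschitz.
Context {R : realType} {n : nat} {d : 'I_n -> measure_display}
  {T : forall i, measurableType (d i)}.
Implicit Types (x y : prod_space T) (psi : prod_space T -> R[i]).

(** These half planes are the preimages under the real part of the open rays that generate the Borel
    sets of the line. *)
Lemma lt_Re_open (a : R) :
  open ([set z | a < complex.Re z] : set R[i]^o).
Proof.
rewrite openE => z /= az; apply/nbhs_ballP; exists (complex.Re z - a)%:C => /=.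
  by rewrite ltcR subr_gt0.
move=> w; rewrite /ball /= normc_def ltcR -normc_sqrtE => zw.
have := le_lt_trans (Re_le_normc _) zw; rewrite Re_subc; lra.
Qed.

Lemma lt_Im_open (a : R) :
  open ([set z | a < complex.Im z] : set R[i]^o).
Proof.
rewrite openE => z /= az; apply/nbhs_ballP; exists (complex.Im z - a)%:C => /=.
  by rewrite ltcR subr_gt0.
move=> w; rewrite /ball /= normc_def ltcR -normc_sqrtE => zw.
have := le_lt_trans (le_trans (ler_norm _) (normr_Im_le _)) zw; rewrite Im_subc; lra.
Qed.

Lemma measurable_Re : measurable_fun setT (fun z : borelC R => complex.Re z : R).
Proof.
move=> mT; apply: (measurability _ (RGenOInfty.measurableE R)) => //.
move=> _ [_ [a ->] <-]; rewrite setTI; apply: sub_sigma_algebra.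
by have := @lt_Re_open a; congr open; apply/seteqP; split=> z /=; rewrite in_itv/= andbT.
Qed.

Lemma measurable_Im : measurable_fun setT (fun z : borelC R => complex.Im z : R).
Proof.
move=> mT; apply: (measurability _ (RGenOInfty.measurableE R)) => //.
move=> _ [_ [a ->] <-]; rewrite setTI; apply: sub_sigma_algebra.
by have := @lt_Im_open a; congr open; apply/seteqP; split=> z /=; rewrite in_itv/= andbT.
Qed.

Lemma hamming_upd x j (t : T j) : t != x j -> hamming (upd x t) x = 1%N.
Proof.
move=> tx; rewrite /hamming (_ : [set _ | _]%SET = [set j]%SET) ?cards1//.
apply/setP => k; rewrite !inE; have [<-|kj] := eqVneq j k.
  by rewrite upd_eq tx.
by rewrite upd_neq// eqxx.
Qed.

(** Walk from [x] to [y] by replacing one coordinate at a time: [n] steps, each changing [psi] by at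
    most 1. *)
Lemma lipschitz_bounded psi :
  (forall x j (t : T j), normc (psi (upd x t) - psi x) <= 1) ->
  forall x y, normc (psi y - psi x) <= n%:R.
Proof.
move=> lip x y.
pose z s := foldr (fun j u => upd u (y j)) x s.
have zE s k : z s k = if k \in s then y k else x k.
  elim: s => //= j s IH; have [<-|jk] := eqVneq j k.
    by rewrite upd_eq mem_head.
  by rewrite upd_neq// IH inE eq_sym (negbTE jk).
have zs s : normc (psi (z s) - psi x) <= (size s)%:R.
  elim: s => [|j s IH] /=; first by rewrite subrr normc0.
  rewrite -add1n natrD -[_ - psi x](subrKA (psi (z s))).
  exact: le_trans (le_normcD _ _) (lerD (lip _ _ _) IH).
have := zs (enum 'I_n); rewrite size_enum_ord (_ : z _ = y)//.
by apply: functional_extensionality_dep => k; rewrite zE mem_enum.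
Qed.

(** Supplies boundedness where no [L] is given, by comparison with the value at the default [point]
    of the product. *)
Lemma cbounded_measurable_lipschitz psi :
  measurable_fun setT (psi : _ -> borelC R) ->
  (forall x j (t : T j), normc (psi (upd x t) - psi x) <= 1) ->
  cbounded_measurable psi /\
  (forall x, normc (psi x) <= normc (psi point) + n%:R).
Proof.
move=> mpsi lip.
have bd x : normc (psi x) <= normc (psi point) + n%:R.
  rewrite -[X in normc X <= _](subrK (psi point)) addrC.
  exact: le_trans (le_normcD _ _) (lerD _ (lipschitz_bounded lip _ _)).
split=> //; split; split.
- exact: (measurableT_comp measurable_Re mpsi).
- exists (normc (psi point) + n%:R) => x.
  exact: le_trans (normr_Re_le _) (bd x).
- exact: (measurableT_comp measurable_Im mpsi).
- exists (normc (psi point) + n%:R) => x.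
  exact: le_trans (normr_Im_le _) (bd x).
Qed.

End hamming_lipschitz.

(** * Nonvanishing and two-sided bounds for the expectation *)

Unset Implicit Arguments.

Theorem theorem1p1 (R : realType) (n m : nat)
  (d : 'I_n -> measure_display) (T : forall j : 'I_n, measurableType (d j))
  (P : forall j : 'I_n, probability (T j) R)
  (phi : 'I_m -> prod_space T -> R[i])
  (r c : nat) (J : 'I_m -> {set 'I_n}) (lambda : R[i]) :
  (2 <= r)%N -> (1 <= c)%N ->
  (forall i, measurable_fun [set: prod_space T] (phi i : _ -> borelC R)) ->
  (forall i (x y : prod_space T),
     hamming x y = 1%N -> normc (phi i x - phi i y) <= 1) ->
  (forall i, (#|J i| <= r)%N) ->
  (forall i (x y : prod_space T),
     (forall j, j \in J i -> x j = y j) -> phi i x = phi i y) ->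
  (forall j : 'I_n, (#|[set i : 'I_m | j \in J i]%SET| <= c)%N) ->
  normc lambda <= 1 / (3 * c%:R * Num.sqrt (r%:R - 1)) ->
  let f := fun x : prod_space T => \sum_(i < m) phi i x in
  let Eexp := cexpectation (prod_probability P) (fun x => cexp (lambda * f x)) in
  Eexp != 0 /\
  (forall L : R, 0 < L ->
     (forall i (x : prod_space T), normc (phi i x) <= L) ->
     expR (- (normc lambda * m%:R * L)) *
       cos (pi / (4 * Num.sqrt (r%:R - 1))) ^+ n <= normc Eexp /\
     normc Eexp <= expR (normc lambda * m%:R * L)).
Proof.
move=> r2 c1 mphi lip Jr dep Jc hlam f Eexp.
have upd_lip i x j (t : T j) : normc (phi i (upd x t) - phi i x) <= 1.
  (* An update by the old value has Hamming distance 0, which the Lipschitz hypothesis does not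
     cover. *)
  have [->|tx] := eqVneq t (x j); last exact/lip/hamming_upd.
  by rewrite upd_id subrr normc0.
have adm : admissible J phi.
  move=> i; split=> [|//|j jJ x t].
    by have [] := cbounded_measurable_lipschitz (mphi i) (upd_lip i).
  apply: dep => k kJ; rewrite upd_neq//.
  by apply: contraNneq jJ => ->.
pose g : R := 2 / 3 / Num.sqrt (r%:R - 1).
have bounds (M : R) (fM : forall y, normc (f y) <= M) :=
  normc_expectation_ge P r2 c1 Jr Jc hlam adm fM.
(* Since 1 < r, the bound 7/9 holds for the first power of the cosine. *)
have cg : 0 < cos g.
  rewrite lt_def cos_gam_ge0// andbT; apply/eqP => c0.
  by have : 7 / 9 <= cos g ^+ 1 := cos_gam_ge r2 r2; rewrite expr1 c0; lra.
split.
  (* Any finite bound on |f| suffices for nonvanishing; this one comes from the Lipschitz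
     condition. *)
  pose M := \sum_(i < m) (normc (phi i point) + n%:R) : R.
  have /bounds/andP[+ _] : forall y, normc (f y) <= M.
    move=> y; rewrite /f /M; elim/big_rec2: _ => [|i a b _ ab].
      by rewrite normc0.
    apply: le_trans (le_normcD _ _) (lerD _ ab).
    by have [_] := cbounded_measurable_lipschitz (mphi i) (upd_lip i); exact.
  move=> h; apply/eqP => E0; move: h; rewrite -/Eexp E0 normc0.
  by rewrite leNgt mulr_gt0 ?expR_gt0 ?exprn_gt0.
move=> L L0 phiL.
have fL : forall y, normc (f y) <= m%:R * L.
  move=> y; apply: le_trans (normc_sum_le _ _) _ => [i|]; first exact: phiL.
  by rewrite -[X in _ <= X%:R * _](size_enum_ord m) ?enumT.
have /andP[lo up] := bounds _ fL.
split; last by rewrite -mulrA.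
rewrite -mulrA; apply: le_trans lo; rewrite ler_wpM2l ?expR_ge0//.
(* The sharper [cos g] is weakened to the stated cosine, whose nonnegativity makes [n]-th powers
   monotone. *)
have := @cos_pi4_le R r r2; rewrite -/g => /andP[c0 cle].
by apply: lerXn2r => //; rewrite nnegrE ltW.
Qed.
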